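(* Fix an integer $n\ge3$. Then $$\lim_{r\to\infty}\rho(A_{n,r})=\Bigl(\frac{27}{4}\Bigr)^{1/n}.$$
   Context: For integers $n\ge3$ and $r\ge1$, the digraph $\Gamma_{n,r}$ has vertex set $V(\Gamma_{n,r})=\{1,2,\dots,rn-2r+2\}$ and directed edge set $E(\Gamma_{n,r})$ defined by $E(\Gamma_{n,1})=\{(j,j+1):1\le j\le n-1\}\cup\{(n,1)\}$; $E(\Gamma_{n,2})=E(\Gamma_{n,1})\cup\{(1,n+1)\}\cup\{(j,j+1):n+1\le j\le 2n-3\}\cup\{(2n-2,n)\}$; and for $r\ge3$, $E(\Gamma_{n,r})=E(\Gamma_{n,2})\cup\bigcup_{i=1}^{r-2}F_i$, where $F_i=\{(in-2i+2,\,in+n-2i+1)\}\cup\{(j,j+1):in+n-2i+1\le j\le in+2n-2i-3\}\cup\{(in+2n-2i-2,\,in+n-2i)\}$. (For $n=3$ the middle path parts are empty.) The adjacency matrix $A_{n,r}$ is the $(0,1)$-matrix indexed by $V(\Gamma_{n,r})$ whose $(u,v)$-entry is $1$ if and only if $(u,v)\in E(\Gamma_{n,r})$. $\rho(M)$ denotes the spectral radius of a square matrix $M$ (maximum modulus of its complex eigenvalues). *)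

(* Defs.v *)
From HB Require Import structures.
From mathcomp Require Import all_boot all_order all_algebra.
From mathcomp Require Import all_classical all_reals all_analysis.
From mathcomp Require Import complex.

Set Implicit Arguments.
Unset Strict Implicit.
Unset Printing Implicit Defensive.

Import Order.TTheory GRing.Theory Num.Theory.
Import numFieldNormedType.Exports.

Local Open Scope classical_set_scope.
Local Open Scope complex_scope.
Local Open Scope ring_scope.

Definition nvert (n r : nat) : nat := (r * n - 2 * r + 2)%N.

(* The edge relation is on vertex labels 1, 2, ..., nvert n r.  For n >= 3 and
   r >= 1 no natural-number subtraction below is truncated, except r - 2 in edge
   when r = 1, where the union over i = 1, ..., r - 2 is empty anyway. *)
Definition edge1 (n : nat) : rel nat := fun u v =>
  [&& (1 <= u)%N, (u <= n - 1)%N & v == u.+1] || ((u == n) && (v == 1%N)).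

Definition edge2 (n : nat) : rel nat := fun u v =>
  [|| (u == 1%N) && (v == (n + 1)%N),
      [&& (n + 1 <= u)%N, (u <= 2 * n - 3)%N & v == u.+1]
    | (u == (2 * n - 2)%N) && (v == n)].

Definition edgeF (n i : nat) : rel nat := fun u v =>
  [|| (u == (i * n - 2 * i + 2)%N) && (v == (i * n + n - 2 * i + 1)%N),
      [&& (i * n + n - 2 * i + 1 <= u)%N, (u <= i * n + 2 * n - 2 * i - 3)%N
        & v == u.+1]
    | (u == (i * n + 2 * n - 2 * i - 2)%N) && (v == (i * n + n - 2 * i)%N)].

Definition edge (n r : nat) : rel nat := fun u v =>
  [|| edge1 n u v,
      (2 <= r)%N && edge2 n u v
    | has (fun i => edgeF n i u v) (iota 1 (r - 2))].

(* The ordinal i : 'I_(nvert n r) stands for the vertex labelled i + 1. *)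
Definition adj (R : realType) (n r : nat) : 'M[R[i]]_(nvert n r) :=
  \matrix_(u, v) (edge n r u.+1 v.+1)%:R.

(* The supremum is a maximum when N > 0, see spectral_radius_max. *)
Definition spectral_radius (R : realType) (N : nat) (A : 'M[R[i]]_N) : R :=
  sup [set ComplexField.Normc.normc z | z in [set z : R[i] | eigenvalue A z]].

Lemma spectral_radius_max (R : realType) (N : nat) (A : 'M[R[i]]_N) :
  (0 < N)%N ->
  (exists2 z, eigenvalue A z &
     ComplexField.Normc.normc z = spectral_radius A) /\
  (forall z, eigenvalue A z ->
     ComplexField.Normc.normc z <= spectral_radius A).
Proof.
move=> N0; set f := @ComplexField.Normc.normc R.
have [s Es] := closed_field_poly_normal (char_poly A).
rewrite (monicP (char_poly_monic A)) scale1r in Es.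
have evE z : eigenvalue A z = (z \in s).
  by rewrite eigenvalue_root_char Es root_prod_XsubC.
have s0 : s != [::].
  apply/eqP => s0; have := size_char_poly A.
  by rewrite Es s0 big_nil size_poly1 => -[] E0; rewrite -E0 in N0.
have [m ms mmax] : exists2 m, m \in s & forall z, z \in s -> f z <= f m.
  case: s s0 {Es evE} => // x s _.
  elim: s x => [|y s IH] x.
    by exists x; rewrite ?mem_head // => z; rewrite inE => /eqP ->.
  have [m ms mmax] := IH y.
  have [xm|mx] := leP (f x) (f m).
    exists m; first by rewrite inE ms orbT.
    by move=> z; rewrite inE => /orP[/eqP ->//|/mmax].
  exists x; first exact: mem_head.
  move=> z; rewrite inE => /orP[/eqP ->//|/mmax zm].
  exact: le_trans zm (ltW mx).
have ub : ubound [set f z | z in [set z | eigenvalue A z]] (f m).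
  by move=> _ [z /= zA <-]; apply: mmax; rewrite -evE.
have inS z : eigenvalue A z -> [set f z | z in [set z | eigenvalue A z]] (f z).
  by move=> zA; exists z.
have mA : eigenvalue A m by rewrite evE.
have srE : spectral_radius A = f m.
  apply/eqP; rewrite eq_le; apply/andP; split.
    by apply: ge_sup => //; exists (f m); exact: inS.
  by apply: ub_le_sup; [exists (f m) | exact: inS].
by split; [exists m | move=> z zA; rewrite srE; apply: mmax; rewrite -evE].
Qed.

(* Main.v *)
Require Import Defs.
From HB Require Import structures.
From mathcomp Require Import all_boot all_order all_algebra.
From mathcomp Require Import zify ring lra.
From mathcomp Require Import all_classical all_reals all_analysis.
From mathcomp Require Import complex.
From mathcomp Require polyrcf.

(** Put d = n - 2.  The digraph has r + 2 backbone vertices T_0, ..., T_(r+1)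
    (labels 2, 1, d + 2, 2d + 2, ...), with edges T_(k+1) -> T_k, and from
    each T_k with k < r a path of length d to T_(k+2).  So a walk on the
    backbone makes steps -1 at cost 1 and +2 at cost d; a closed walk uses two
    backward steps for every forward one, and all cycle lengths are multiples
    of d + 2 = n.

    Look for a left eigenvector for l of the form f(T_k) = l^k y_k, divided by
    l at each step along a path.  The equation holds automatically inside
    the paths, and at T_k it becomes, with s = l^(-n),
      y_k = y_(k+1) + s y_(k-2),
    where y_k = 0 for k < 0 and for k > r + 1 (lemma [inflowE]).  Both bounds
    are read off this scalar recurrence.

    Upper bound, for every r.  For s = 4/27, that is l^n = 27/4, the
    characteristic equation 1 = x + s / x^2 has the double root x = 2/3.  The
    weights obtained from y_k = (2/3)^k are positive and satisfy q A <= l q,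
    the ends of the chain only losing terms.  This bounds every eigenvalue by
    l ([eigenvalue_le], [eigenvalue_adj_le]).

    Lower bound.  Starting with y_0 = y_1 = y_2 = 1 the recurrence defines
    polynomials in s, the cutoff polynomials D_k, and a zero s of D_(r+2) gives
    a genuine eigenvector, hence the eigenvalue s^(-1/n)
    ([eigenvalue_adj_cutoff]).  For a given s > 4/27 some D_M is nonpositive at
    s: otherwise the ratios D_(k+1)/D_k would decrease forever, by at least
    a fixed amount every two steps, because x^2 (1 - x) <= 4/27 ([cutoff_not_pos]).
    So D_M has a zero in (0, s], and then so does every D_m with m >= M, since
    positivity on an interval [0, b] is inherited downwards
    ([cutoff_pos_pred]).  Letting s decrease to 4/27 gives the limit. *)

Set Implicit Arguments.
Unset Strict Implicit.
Unset Printing Implicit Defensive.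

Import Order.TTheory GRing.Theory Num.Theory.
Import numFieldNormedType.Exports.

Local Open Scope classical_set_scope.
Local Open Scope ring_scope.

(** * In-neighbours in the digraph *)

(** The chain of single edges ends with d + 2 -> 1 -> 2, so the labels of T_0
    and T_1 fall outside the arithmetic progression of the others. *)
Definition backbone (d k : nat) : nat :=
  if k is k'.+2 then (k'.+1 * d + 2)%N else (2 - k)%N.

Lemma edge_to1 d r u : (0 < d)%N -> (0 < u)%N ->
  edge d.+2 r u 1 = (u == d.+2).
Proof.
move=> d0 u0; rewrite /edge.
have -> : has (fun i => edgeF d.+2 i u 1) (iota 1 (r - 2)) = false.
  by apply/hasPn => i; rewrite mem_iota /edgeF => _; nia.
by rewrite /edge1 /edge2; lia.
Qed.

Lemma edge_to2 d r u : (0 < d)%N -> (0 < u)%N ->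
  edge d.+2 r u 2 = (u == 1%N).
Proof.
move=> d0 u0; rewrite /edge.
have -> : has (fun i => edgeF d.+2 i u 2) (iota 1 (r - 2)) = false.
  by apply/hasPn => i; rewrite mem_iota /edgeF => _; nia.
by rewrite /edge1 /edge2; lia.
Qed.

(** The labels from 3 on come in r blocks of length d: block j lists the
    vertices after T_j on the path from T_j to T_(j+2), the last of
    them (k + 1 = d) being T_(j+2) itself, which is also entered from T_(j+3). *)
Lemma edge_to_path d r j k u : (0 < d)%N -> (0 < u)%N ->
    (j < r)%N -> (k < d)%N ->
  edge d.+2 r u (j * d + k + 3) =
    (u == if k is k'.+1 then (j * d + k' + 3)%N else backbone d j)
    || [&& k.+1 == d, (j.+1 < r)%N & u == backbone d j.+3].
Proof.
move=> d0 u0 jr kd; apply/idP/idP.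
  case/or3P.
  - rewrite /edge1 => H; have j0 : j = 0%N by nia.
    by subst j; case: k kd H => [|k] kd H /=; lia.
  - case/andP => r2; rewrite /edge2 => H.
    have [j0|[j0|j2]] : j = 0%N \/ j = 1%N \/ (2 * d <= j * d)%N by nia.
    + by subst j; case: k kd H => [|k] kd H /=; lia.
    + by subst j; case: k kd H => [|k] kd H /=; lia.
    + lia.
  - case/hasP => i; rewrite mem_iota /edgeF => ir H.
    have [ji|[ji|[ji|ji]]] :
      (j.+1 * d <= i * d)%N \/ j = i \/ j = i.+1 \/ (i.+2 * d <= j * d)%N by nia.
    + lia.
    + by subst j; case: k kd H => [|k] kd H /=; lia.
    + by subst j; case: k kd H => [|k] kd H; case: i ir jr H => [|i] ir jr H /=; lia.
    + lia.
case/orP.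
- move=> /eqP ->; case: j jr => [|[|j]] jr.
  + apply/orP; left; rewrite /edge1; case: k kd => [|k] kd /=; lia.
  + apply/orP; right; apply/orP; left; rewrite /edge2.
    by case: k kd => [|k] kd /=; lia.
  + apply/orP; right; apply/orP; right; apply/hasP.
    exists j.+1; first by rewrite mem_iota; lia.
    by rewrite /edgeF; case: k kd => [|k] kd /=; lia.
- case/and3P => kd1 jr1 /eqP ->; case: j jr jr1 => [|j] jr jr1.
  + by apply/orP; right; apply/orP; left; rewrite /edge2 /=; lia.
  + apply/orP; right; apply/orP; right; apply/hasP.
    exists j.+1; first by rewrite mem_iota; lia.
    by rewrite /edgeF /=; lia.
Qed.

Lemma label_ind (d r : nat) (P : nat -> Prop) : (0 < d)%N ->
    P 1%N -> P 2%N ->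
    (forall j k, (j < r)%N -> (k < d)%N -> P (j * d + k + 3)%N) ->
  forall w, (0 < w <= r * d + 2)%N -> P w.
Proof.
move=> d0 P1 P2 P3 [|[|[|w]]] // /andP[_ hw].
rewrite -(addn3 w) (divn_eq w d); apply: P3; last exact: ltn_pmod.
by rewrite ltn_divLR //; lia.
Qed.

(** * Reduction to a scalar recurrence *)

Section InflowSums.
Variables (F : fieldType) (d r : nat) (l s : F) (y : nat -> F).
Hypotheses (d0 : (0 < d)%N) (r0 : (0 < r)%N).
Hypotheses (l0 : l != 0) (sl : s * l ^+ d.+2 = 1).

(** The ansatz: l^k y_k at T_k, divided by l at each step along the path that
    leaves T_k. *)
Definition spread (w : nat) : F :=
  match w with
  | 0 => 0
  | 1 => l * y 1%N
  | 2 => y 0%N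
  | w'.+3 => let j := (w' %/ d)%N in let k := (w' %% d)%N in
     if k.+1 == d then l ^+ j.+2 * y j.+2 else l ^+ j * y j / l ^+ k.+1
  end.

Arguments spread : simpl never.

(** Up to the factor l^(k+1), what T_k receives from T_(k+1) and from T_(k-2);
    the first is missing for the last backbone vertex, k = r + 1. *)
Definition step (k : nat) : F :=
  (if (k <= r)%N then y k.+1 else 0) +
  (if k is k'.+2 then s * y k' else 0).

Lemma spread_path j k : (k < d)%N ->
  spread (j * d + k + 3) =
  if k.+1 == d then l ^+ j.+2 * y j.+2 else l ^+ j * y j / l ^+ k.+1.
Proof.
by move=> kd; rewrite addn3 /spread divnMDl // divn_small // addn0 modnMDl modn_small.
Qed.

Lemma spread_backbone k : spread (backbone d k) = l ^+ k * y k.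
Proof.
case: k => [|[|k]] /=; first by rewrite expr0 mul1r.
  by rewrite expr1.
have -> : (k.+1 * d + 2 = k * d + d.-1 + 3)%N by lia.
by rewrite spread_path ?prednK ?eqxx.
Qed.

(** The entry at w of the row vector [spread] times the adjacency matrix. *)
Definition inflow (w : nat) : F :=
  \sum_(u < r * d + 2) spread u.+1 * (edge d.+2 r u.+1 w)%:R.

Lemma inflow_single w a : (0 < a <= r * d + 2)%N ->
    (forall u, (0 < u)%N -> edge d.+2 r u w = (u == a)) ->
  inflow w = spread a.
Proof.
move=> /andP[a0 aN] H; have aN' : (a.-1 < r * d + 2)%N by lia.
rewrite /inflow (bigD1 (Ordinal aN')) //= prednK // H // eqxx mulr1.
rewrite big1 ?addr0 // => i; rewrite -val_eqE /= => ia.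
by rewrite H //; case: eqP => [?|_]; [lia | rewrite mulr0].
Qed.

Lemma inflow_pair w a b : (0 < a <= r * d + 2)%N -> (0 < b <= r * d + 2)%N ->
    a != b -> (forall u, (0 < u)%N -> edge d.+2 r u w = (u == a) || (u == b)) ->
  inflow w = spread a + spread b.
Proof.
move=> /andP[a0 aN] /andP[b0 bN] ab H.
have aN' : (a.-1 < r * d + 2)%N by lia.
have bN' : (b.-1 < r * d + 2)%N by lia.
rewrite /inflow (bigD1 (Ordinal aN')) //= (bigD1 (Ordinal bN')) /=; last first.
  by rewrite -val_eqE /=; lia.
rewrite !prednK // !H // !eqxx orbT !mulr1.
rewrite big1 ?addr0 // => i; rewrite -!val_eqE /= => iab.
by rewrite H //; case: orP => [?|_]; [lia | rewrite mulr0].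
Qed.

(** Inside a path the eigenvalue equation holds whatever y is, since the value
    is divided by l at each step; on the backbone it is the recurrence.  The
    value carried from T_k to T_(k+2) is l^k y_k / l^(d-1) = l^(k+3) s y_k,
    whence the factor s. *)
Lemma inflowE w : (0 < w <= r * d + 2)%N ->
  inflow w = l * spread w \/
  exists2 k, (k <= r.+1)%N &
    spread w = l ^+ k * y k /\ inflow w = l ^+ k.+1 * step k.
Proof.
move: w; apply: label_ind => //.
- right; exists 1%N; first lia; split; first by rewrite (spread_backbone 1).
  rewrite (@inflow_single _ (backbone d 2)).
  + by rewrite spread_backbone /step r0 addr0.
  + by rewrite /=; nia.
  + by move=> u u0; rewrite edge_to1 //= ; congr (_ == _); lia.
- right; exists 0%N; first lia; split; first by rewrite (spread_backbone 0).
  rewrite (@inflow_single _ (backbone d 1)).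
  + by rewrite spread_backbone /step leq0n addr0.
  + by rewrite /=; nia.
  + by move=> u u0; rewrite edge_to2.
move=> j k jr kd.
have jdr : (j.+1 * d <= r * d)%N by rewrite leq_mul2r jr orbT.
(* a is the predecessor of the vertex on its path *)
set a := if k is k'.+1 then (j * d + k' + 3)%N else backbone d j.
have fa : spread a = l ^+ j * y j / l ^+ k.
  rewrite /a; case: k kd {a} => [|k] kd.
    by rewrite spread_backbone expr0 divr1.
  rewrite spread_path 1?ltnW //; case: eqP => [?|//]; lia.
have aN : (0 < a <= r * d + 2)%N.
  rewrite /a; case: (k) kd => [|k'] kd; last by lia.
  by case: (j) jr jdr => [|[|j']] /=; nia.
have [kd1|kd1] := eqVneq k.+1 d; last first.
  left; rewrite (@inflow_single _ a) //; last first.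
    by move=> u u0; rewrite edge_to_path // (negPf kd1) orbF.
  rewrite fa spread_path // (negPf kd1) exprS; field.
  by rewrite l0 expf_neq0.
right; exists j.+2; first lia; split.
  by rewrite spread_path // kd1 eqxx.
have fa' : spread a = l ^+ j.+3 * (s * y j).
  have -> : l ^+ j.+3 * (s * y j) = (s * l ^+ d.+2) * (l ^+ j * y j / l ^+ k).
    rewrite -kd1 -[in RHS]addn3 -[in LHS]addn3 !exprD; field.
    by rewrite expf_neq0.
  by rewrite sl mul1r.
rewrite /step; have [jr1|jr1] := leqP j.+2 r.
  rewrite (@inflow_pair _ a (backbone d j.+3)) //.
  + by rewrite fa' spread_backbone mulrDr addrC.
  + have : (j.+2 * d <= r * d)%N by rewrite leq_mul2r jr1 orbT.
    by rewrite /=; lia.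
  + rewrite /a /=; case: (k) kd => [|k'] kd; last by lia.
    by case: (j) => [|[|j']] /=; nia.
  + by move=> u u0; rewrite edge_to_path // kd1 eqxx jr1.
rewrite (@inflow_single _ a) ?fa' ?add0r // => u u0.
by rewrite edge_to_path // [(j.+1 < r)%N]leqNgt jr1 /= andbF orbF.
Qed.

End InflowSums.

(** * Zeros of the cutoff polynomials *)

(** The solution of the recurrence y_(k+1) = y_k - s y_(k-2) with
    y_0 = y_1 = y_2 = 1, as a polynomial in s. *)
Fixpoint cutoff (R : comNzRingType) (m : nat) : {poly R} :=
  if m is (m'.+2 as m1).+1 then cutoff R m1 - 'X * cutoff R m' else 1.

Lemma cutoffS (R : comNzRingType) m (s : R) :
  (cutoff R m.+3).[s] = (cutoff R m.+2).[s] - s * (cutoff R m).[s].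
Proof. by rewrite /= !hornerE. Qed.

Arguments cutoff : simpl never.

Lemma cutoff_at0 (R : comNzRingType) m : (cutoff R m).[0] = 1 :> R.
Proof.
suff H k : (k <= m)%N -> (cutoff R k).[0] = 1 :> R by apply: H.
elim: m k => [|m IH] [|[|[|k]]] km; try by rewrite /cutoff hornerE.
by rewrite cutoffS mul0r subr0 IH.
Qed.

Lemma ivt_root (R : rcfType) (p : {poly R}) (b : R) :
    0 < p.[0] -> 0 <= b -> p.[b] <= 0 -> exists2 x, 0 < x <= b & p.[x] = 0.
Proof.
move=> p0 b0 pb.
have [x /andP[x0 xb] /rootP px] : exists2 x, 0 <= x <= b & root (- p) x.
  by apply: poly_ivt => //; rewrite !hornerN oppr_le0 oppr_ge0 (ltW p0).
have {}px : p.[x] = 0 by apply/eqP; rewrite -oppr_eq0 -hornerN px.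
exists x; rewrite // xb lt_neqAle x0 !andbT.
by apply/eqP => xe; move: p0; rewrite [X in p.[X]]xe px ltxx.
Qed.

Lemma first_root (R : rcfType) (p : {poly R}) (b : R) :
    0 < p.[0] -> 0 <= b -> p.[b] <= 0 ->
  exists2 x, 0 < x <= b & p.[x] = 0 /\ forall t, 0 <= t < x -> 0 < p.[t].
Proof.
move=> p0 b0 pb.
have pos_before x : (forall t, 0 < t < x -> p.[t] != 0) ->
    forall t, 0 <= t < x -> 0 < p.[t].
  move=> nz t /andP[t0 tx]; rewrite ltNge; apply/negP => pt.
  have [z /andP[z0 zt] /eqP] := ivt_root p0 t0 pt.
  by apply/negP/nz; rewrite z0 (le_lt_trans zt).
have [z /andP[z0 zb] pz] := ivt_root p0 b0 pb.
have pn0 : p != 0 by apply: contraTneq p0 => ->; rewrite horner0 ltxx.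
case: (polyrcf.next_rootP p 0 b) => [pe|x _ px xin xn|c _ _ cn].
- by rewrite pe eqxx in pn0.
- move: xin; rewrite in_itv /= => /andP[x0 xb].
  exists x; first by rewrite x0 ltW.
  split=> //; apply: pos_before => t /andP[t0 tx].
  by apply: xn; rewrite in_itv /= t0.
- have z_eq : z = b.
    apply/eqP; rewrite eq_le zb /= leNgt; apply/negP => lt_zb.
    by have := cn z; rewrite in_itv /= z0 lt_zb rootE pz eqxx => /(_ isT).
  exists z; rewrite ?z0 //; split=> //; apply: pos_before => t /andP[t0 tz].
  by apply: cn; rewrite in_itv /= t0 -z_eq.
Qed.

(** At the first zero x of D_(m+2) in [0, b], the earlier D_m is nonnegative by
    induction on the intervals [0, z] with z < x; so
    D_(m+3)(x) = - x D_m(x) <= 0, against the hypothesis. *)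
Lemma cutoff_pos_pred (R : rcfType) m (b : R) :
    (forall t, 0 <= t <= b -> 0 < (cutoff R m.+1).[t]) ->
  forall t, 0 <= t <= b -> 0 < (cutoff R m).[t].
Proof.
elim/ltn_ind: m b => -[|[|m]] IH b H t tb; try by rewrite /cutoff hornerE.
rewrite ltNge; apply/negP => nt; case/andP: tb => t0 tb.
have [x /andP[x0 xt] [px xpos]] : exists2 x, 0 < x <= t &
    (cutoff R m.+2).[x] = 0 /\ forall t, 0 <= t < x -> 0 < (cutoff R m.+2).[t].
  by apply: first_root => //; rewrite cutoff_at0.
have pos2 z : 0 <= z < x -> 0 < (cutoff R m).[z].
  move=> /andP[z0 zx]; apply: (IH m _ z) => //; last by rewrite z0 lexx.
  move=> u /andP[u0 uz]; apply: (IH m.+1 _ z) => //; last by rewrite u0.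
  by move=> v /andP[v0 vz]; apply: xpos; rewrite v0 (le_lt_trans vz).
have ge0 : 0 <= (cutoff R m).[x].
  rewrite leNgt; apply/negP => neg.
  have [u /andP[u0 ux] pu] : exists2 u, 0 < u <= x & (cutoff R m).[u] = 0.
    by apply: ivt_root; rewrite ?cutoff_at0 // ltW.
  have [ue|une] := eqVneq u x; first by rewrite -ue pu ltxx in neg.
  by have := pos2 u; rewrite (ltW u0) lt_neqAle une ux pu ltxx => /(_ isT).
have := H x; rewrite (ltW x0) (le_trans xt tb) cutoffS px sub0r => /(_ isT).
by rewrite oppr_gt0 ltNge mulr_ge0 // ltW.
Qed.

(** The maximum of x^2 (1 - x) is attained at x = 2/3; this is where the
    constant 27/4 comes from. *)
Lemma sqr_mul1B_le (R : realFieldType) (x : R) : 0 <= x -> x ^+ 2 * (1 - x) <= 4 / 27.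
Proof.
move=> x0; rewrite -subr_ge0.
have -> : 4 / 27 - x ^+ 2 * (1 - x) = (x - 2 / 3) ^+ 2 * (x + 1 / 3) by field.
by rewrite mulr_ge0 ?sqr_ge0 //; lra.
Qed.

(** If all D_k(s) were positive, the ratios q_k = D_(k+1)/D_k would satisfy
    q_(k+2) = 1 - s / (q_(k+1) q_k).  They decrease, so that
    q_(k+2) <= 1 - s / q_k^2 <= q_k - (s - 4/27), and become negative. *)
Lemma cutoff_not_pos (R : archiRealFieldType) (s : R) : 4 / 27 < s ->
  exists m, (cutoff R m).[s] <= 0.
Proof.
move=> hs; pose D m := (cutoff R m).[s].
have [[m Dm]|npos] := pselect (exists m, D m <= 0); first by exists m.
have Dpos m : 0 < D m by rewrite ltNge; apply/negP => Dm; apply: npos; exists m.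
pose q m := D m.+1 / D m.
have qpos m : 0 < q m by rewrite divr_gt0.
have qS m : q m.+2 = 1 - s / (q m.+1 * q m).
  rewrite /q {1}/D cutoffS -/(D _) -/(D _); field.
  by rewrite !gt_eqF.
have q0 : q 0%N = 1 by rewrite /q /D /cutoff !hornerE ?invr1 ?mulr1.
have q1 : q 1%N = 1 by rewrite /q /D /cutoff !hornerE ?invr1 ?mulr1.
have q_decr m : q m.+1 <= q m /\ q m.+2 <= q m.+1.
  elim: m => [|m [h1 h2]].
    by rewrite qS q0 q1 mulr1 divr1; split; lra.
  split=> //; rewrite [q m.+3]qS [leRHS]qS lerD2l lerN2.
  have le_qq : q m.+2 * q m.+1 <= q m.+1 * q m.
    by rewrite mulrC ler_pM2l ?qpos // (le_trans h2).
  rewrite ler_pM2l; last lra.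
  by rewrite lef_pV2 // posrE; exact: mulr_gt0.
have q_le1 m : q m <= 1.
  by elim: m => [|m IH]; [rewrite q0 | apply: le_trans (q_decr m).1 IH].
have q_drop m : q m.+2 <= q m - (s - 4 / 27).
  have x0 := qpos m; have x1 := q_le1 m; have x2 := sqr_mul1B_le (ltW x0).
  apply: (@le_trans _ _ (1 - s / (q m * q m))).
    have le_qq : q m.+1 * q m <= q m * q m by rewrite ler_pM2r // (q_decr m).1.
    rewrite qS lerD2l lerN2 ler_pM2l; last lra.
    by rewrite lef_pV2 // posrE; exact: mulr_gt0.
  rewrite lerBlDl -lerBlDr ler_pdivlMr; last exact: mulr_gt0.
  have : q m ^+ 2 * (s - 4 / 27) <= s - 4 / 27.
    by rewrite ler_piMl ?exprn_ile1 ?(ltW x0) //; lra.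
  by move: x2; rewrite -expr2; set z := q m ^+ 2; lra.
have q_lin j : q j.*2 <= 1 - j%:R * (s - 4 / 27).
  elim: j => [|j IH]; first by rewrite q0 mul0r subr0.
  have dr := q_drop j.*2.
  by rewrite doubleS -natr1; lra.
have [j hj] : exists j, 1 < j%:R * (s - 4 / 27).
  exists (Num.bound (s - 4 / 27)^-1).
  rewrite -ltr_pdivrMr ?subr_gt0 // div1r.
  by apply: archi_boundP; rewrite invr_ge0 subr_ge0 ltW.
by have h1 := qpos j.*2; have h2 := q_lin j; lra.
Qed.

(** Without a zero in (0, s], D_m would be positive on [0, s] because D_m(0) = 1,
    and descending from m to M would give D_M(s) > 0. *)
Lemma cutoff_root (R : realType) (s : R) : 4 / 27 < s ->
  exists M, forall m, (M <= m)%N -> exists2 t, 0 < t <= s & (cutoff R m).[t] = 0.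
Proof.
move=> hs; have s0 : 0 < s by apply: lt_trans hs; lra.
have [M DM] := cutoff_not_pos hs.
exists M => m Mm; apply: contrapT => nr.
have pos : forall t, 0 <= t <= s -> 0 < (cutoff R m).[t].
  move=> t /andP[t0 ts]; rewrite ltNge; apply/negP => nt.
  have [|x /andP[x0 xt] px] := ivt_root _ t0 nt; first by rewrite cutoff_at0.
  by apply: nr; exists x; rewrite // x0 (le_trans xt).
have : forall t, 0 <= t <= s -> 0 < (cutoff R M).[t].
  elim: m Mm pos {nr} => [|m IH]; first by rewrite leqn0 => /eqP ->.
  rewrite leq_eqVlt => /orP[/eqP -> //|Mm pos]; apply: IH => //.
  exact: cutoff_pos_pred.
by move=> /(_ s); rewrite (ltW s0) lexx ltNge DM => /(_ isT).
Qed.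

(** * A weight bound on eigenvalues *)

Lemma eigenvalue_right (F : fieldType) (N : nat) (A : 'M[F]_N) (z : F) :
  eigenvalue A z -> exists2 v : 'cV_N, A *m v = z *: v & v != 0.
Proof.
move=> Az; have : eigenvalue A^T z.
  move: Az; rewrite /eigenvalue /eigenspace -!mxrank_eq0 !mxrank_ker.
  by rewrite -(mxrank_tr (A - _)) linearB /= tr_scalar_mx.
case/eigenvalueP => v vA v0; exists v^T; last by rewrite trmx_eq0.
by rewrite -[A]trmxK -trmx_mul vA linearZ.
Qed.

(** The easy half of the Collatz-Wielandt principle: pair the moduli of a right
    eigenvector with the positive weights q. *)
Lemma eigenvalue_le (C : numFieldType) (N : nat) (A : 'M[C]_N) (q : 'I_N -> C)
    (c z : C) :
    (forall u w, 0 <= A u w) -> (forall u, 0 < q u) ->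
    (forall w, \sum_u q u * A u w <= c * q w) ->
  eigenvalue A z -> `|z| <= c.
Proof.
move=> A0 q0 qA /eigenvalue_right [v Av v0].
have [i vi0] : exists i, v i 0 != 0.
  apply/existsP; apply: contraNT v0; rewrite negb_exists => /forallP v0.
  by apply/eqP/colP => i; rewrite mxE; apply/eqP; have := v0 i; rewrite negbK.
have S0 : 0 < \sum_u q u * `|v u 0|.
  rewrite (bigD1 i) //= ltr_pwDl ?mulr_gt0 ?normr_gt0 //.
  by apply: sumr_ge0 => j _; rewrite mulr_ge0 ?normr_ge0 // ltW.
rewrite -(ler_pM2r S0) mulr_sumr.
apply: (@le_trans _ _ (\sum_u q u * \sum_w A u w * `|v w 0|)).
  apply: ler_sum => u _; rewrite mulrCA ler_pM2l // -normrM.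
  have -> : z * v u 0 = \sum_w A u w * v w 0.
    by have /matrixP/(_ u 0) := Av; rewrite !mxE.
  apply: le_trans (ler_norm_sum _ _ _) _; apply: ler_sum => w _.
  by rewrite normrM ger0_norm.
under eq_bigr do rewrite mulr_sumr.
rewrite exchange_big /= mulr_sumr; apply: ler_sum => w _.
under eq_bigr do rewrite mulrA.
by rewrite -mulr_suml mulrA ler_wpM2r.
Qed.

(** * The two bounds on the spectral radius *)

Lemma nvertE d r : nvert d.+2 r = (r * d + 2)%N.
Proof. by rewrite /nvert; lia. Qed.

Lemma eigenvalue_adj_le (R : realType) d r (l : R) z : (0 < d)%N -> (0 < r)%N ->
    0 < l -> l ^+ d.+2 = 27 / 4 ->
  eigenvalue (adj R d.+2 r) z -> ComplexField.Normc.normc z <= l.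
Proof.
move=> d0 r0 l0 ln.
pose y k : R := (2 / 3) ^+ k.
have y0 k : 0 < y k by rewrite exprn_gt0.
have sl : 4 / 27 * l ^+ d.+2 = 1 by rewrite ln; field.
pose q := spread d l y.
have q0 w : (0 < w <= r * d + 2)%N -> 0 < q w.
  move: w; apply: label_ind => //; rewrite /q.
  + by rewrite mulr_gt0.
  + move=> j k _ kd; rewrite spread_path //.
    have ly i : 0 < l ^+ i * y i by apply: mulr_gt0; rewrite ?exprn_gt0.
    by case: ifP => _; [exact: ly | apply: divr_gt0; rewrite ?exprn_gt0].
(* for k >= 2 this is the equality 1 = 2/3 + (4/27) (3/2)^2, from which a term
   may be missing *)
have step_le k : step r (4 / 27) y k <= y k.
  rewrite /step; case: k => [|[|k]].
  - by rewrite /y leq0n; lra.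
  - by rewrite /y; case: ifP => _; lra.
  - have := y0 k; rewrite /y !exprS; set t := _ ^+ k => t0.
    by case: ifP => _; lra.
move=> zA; rewrite -lecR.
have -> : (ComplexField.Normc.normc z)%:C%C = `|z| by case: z {zA}.
apply: (@eigenvalue_le _ _ _ (fun u => (q u.+1)%:C%C) _ _ _ _ _ zA).
- by move=> u w; rewrite mxE ler0n.
- move=> u; rewrite ltcR; apply: q0; rewrite ltnS leq0n /= -nvertE; exact: ltn_ord.
move=> w; under eq_bigr do rewrite mxE -(rmorph_nat (real_complex R)) -rmorphM.
rewrite -rmorph_sum -rmorphM lecR.
have hw : (0 < w.+1 <= r * d + 2)%N by rewrite /= -nvertE ltn_ord.
have -> : \sum_(u < nvert d.+2 r) q u.+1 * (edge d.+2 r u.+1 w.+1)%:R =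
          inflow d r l y w.+1 by rewrite /inflow; case: _ / (nvertE d r).
have [->//|[k _ [fk ->]]] := inflowE y d0 r0 (lt0r_neq0 l0) sl hw.
by rewrite /q fk mulrA -exprS ler_pM2l ?exprn_gt0.
Qed.

Lemma eigenvalue_adj_cutoff (R : realType) d r (l s : R) : (0 < d)%N -> (0 < r)%N ->
    l != 0 -> s * l ^+ d.+2 = 1 -> (cutoff R r.+2).[s] = 0 ->
  eigenvalue (adj R d.+2 r) l%:C%C.
Proof.
move=> d0 r0 l0 sl root_s.
pose y k := (cutoff R k).[s].
have stepE k : (k <= r.+1)%N -> step r s y k = y k.
  (* the truncation at the end of the chain is harmless as y_(r+2) = 0 *)
  move=> kr; have y_next : (if (k <= r)%N then y k.+1 else 0) = y k.+1.
    by case: leqP => // rk; rewrite /y -root_s; do 2!f_equal; lia.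
  rewrite /step y_next; case: k kr {y_next} => [|[|k]] _.
  - by rewrite /y /cutoff addr0.
  - by rewrite /y /cutoff addr0.
  - by rewrite /y cutoffS subrK.
apply/eigenvalueP; exists (\row_u (spread d l y u.+1)%:C%C); last first.
  have N0 : (0 < nvert d.+2 r)%N by rewrite nvertE addn2.
  apply/eqP => /rowP /(_ (Ordinal N0)); rewrite !mxE /= => /eqP.
  by rewrite /spread /y /cutoff hornerE mulr1 fmorph_eq0 (negPf l0).
apply/rowP => w; rewrite !mxE.
under eq_bigr do rewrite !mxE -(rmorph_nat (real_complex R)) -rmorphM.
rewrite -rmorph_sum -rmorphM; congr (_%:C%C).
have hw : (0 < w.+1 <= r * d + 2)%N by rewrite /= -nvertE ltn_ord.
have -> : \sum_(u < nvert d.+2 r) spread d l y u.+1 * (edge d.+2 r u.+1 w.+1)%:R =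
          inflow d r l y w.+1 by rewrite /inflow; case: _ / (nvertE d r).
have [->//|[k kr [fk ->]]] := inflowE y d0 r0 l0 sl hw.
by rewrite stepE // fk mulrA -exprS.
Qed.

Unset Implicit Arguments.

Theorem proposition5p4 (R : realType) (n : nat) (hn : (3 <= n)%N) :
  (fun r : nat => spectral_radius (adj R n r)) @ \oo
    --> (27%:R / 4%:R : R) `^ (n%:R^-1).
Proof.
case: n hn => [|[|d]] // d0.
have rootK (a : R) : 0 <= a -> (a `^ (d.+2%:R^-1)) ^+ d.+2 = a.
  by move=> a0; rewrite -powR_mulrn ?powR_ge0 // -powRrM mulVf ?powRr1.
set L := _ `^ _.
have L0 : 0 < L by apply: powR_gt0; lra.
have Ln : L ^+ d.+2 = 27 / 4 by apply: rootK; lra.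
apply/cvgrPdist_le => e e0.
(* the second argument of the maximum only keeps l positive *)
pose l := Num.max (L - e) (L / 2).
have l0 : 0 < l by rewrite /l lt_max; apply/orP; right; lra.
have lL : l < L by rewrite /l gt_max; apply/andP; split; lra.
have Lel : L - e <= l by rewrite /l le_max lexx.
have hs : 4 / 27 < (l ^+ d.+2)^-1.
  have -> : 4 / 27 = (L ^+ d.+2)^-1 :> R by rewrite Ln; field.
  by rewrite ltf_pV2 ?posrE ?exprn_gt0 // ltrXn2r // ltW.
have [M HM] := cutoff_root hs.
exists (maxn M 1) => // r /=; rewrite geq_max => /andP[Mr r0].
have N0 : (0 < nvert d.+2 r)%N by rewrite nvertE addn2.
have [[z zA zr] ub] := spectral_radius_max (adj R d.+2 r) N0.
have upper : spectral_radius (adj R d.+2 r) <= L.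
  by rewrite -zr; apply: eigenvalue_adj_le zA.
have [t /andP[t0 ts] rt] := HM r.+2 (leq_trans Mr (leq_addl 2 r)).
pose x := t^-1 `^ d.+2%:R^-1.
have x0 : 0 < x by rewrite powR_gt0 // invr_gt0.
have xn : x ^+ d.+2 = t^-1 by rewrite rootK // invr_ge0 ltW.
have lx : l <= x.
  rewrite -(@ler_pXn2r _ d.+2) ?nnegrE ?(ltW l0) ?(ltW x0) // xn.
  by rewrite -[l ^+ _]invrK lef_pV2 ?posrE ?invr_gt0 ?exprn_gt0.
have lower : x <= spectral_radius (adj R d.+2 r).
  have := ub x%:C%C; rewrite /= expr0n addr0 sqrtr_sqr gtr0_norm //; apply.
  apply: (@eigenvalue_adj_cutoff R d r x t) => //; first exact: lt0r_neq0.
  by rewrite xn mulfV // lt0r_neq0.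
by rewrite ger0_norm; lra.
Qed.
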